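(* Let $\Delta\ge1$ and let $G$ be a graph. If $\mathrm{Err}_G(f_\Delta,f_{\mathrm{sf}})>0$, then $$\mathrm{Err}_G(f_\Delta,f_{\mathrm{sf}})\le 2\cdot\min_{f^*\in\mathcal{F}_{\Delta-1}}\mathrm{Err}_G(f^*,f_{\mathrm{sf}})-1.$$
   Context: Graphs are finite, undirected and unweighted; $\mathcal{G}$ is the set of all such graphs. $f_{\mathrm{sf}}(G)$ is the number of edges of a spanning forest of $G$. The node-distance $d(G,G')$ is the smallest number of modifications transforming $G$ into $G'$, each modification being deletion of a vertex with its incident edges or insertion of a vertex with arbitrary incident edges. A function $h:\mathcal{G}\to\mathbb{R}$ is $c$-Lipschitz if $|h(G)-h(G')|\le c\cdot d(G,G')$ for all $G,G'$; $\mathcal{F}_c$ is the set of all $c$-Lipschitz functions $\mathcal{G}\to\mathbb{R}$. $H\preceq G$ means $H$ is an induced subgraph of $G$, and $\mathrm{Err}_G(g,f)=\max_{H\preceq G}|g(H)-f(H)|$. For $G=(V,E)$ and $\Delta>0$, $\mathcal{P}_\Delta(G)$ is the set of $x\in\mathbb{R}^E$ with $x(e)\ge0$ for all $e$, $\sum_{e\in E[S]}x(e)\le|S|-1$ for all $S\subseteq V$, $|S|\ge2$ ($E[S]$ the edges of the subgraph induced by $S$), and $\sum_{e\ni v}x(e)\le\Delta$ for all $v\in V$; and $f_\Delta(G)=\max_{x\in\mathcal{P}_\Delta(G)}\sum_{e\in E}x(e)$. *)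

(* Defs.v *)
From HB Require Import structures.
From mathcomp Require Import all_boot all_order all_algebra finmap.
From mathcomp Require Import boolp classical_sets reals.

Set Implicit Arguments.
Unset Strict Implicit.
Unset Printing Implicit Defensive.

Import Order.TTheory GRing.Theory Num.Theory.

Local Open Scope fset_scope.

(** Vertices are labelled by natural numbers; an edge is a two-element set of
    vertices.  The side condition is boolean, so graphs with the same vertices
    and edges are (Leibniz) equal. *)
Record graph := Graph {
  vertices : {fset nat};
  edges : {fset {fset nat}};
  _ : [forall e : edges, (fsval e `<=` vertices) && (#|` fsval e| == 2)]
}.

Lemma edgesP (G : graph) (e : {fset nat}) :
  e \in edges G -> (e `<=` vertices G) && (#|` e| == 2).
Proof. by case: G => V E /= /forallP EP eE; apply: (EP [` eE]). Qed.

Lemma graph_eq (G G' : graph) :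
  vertices G = vertices G' -> edges G = edges G' -> G = G'.
Proof.
case: G G' => [V E EP] [V' E' EP'] /= eqV eqE; subst V' E'.
by congr Graph; apply: bool_irrelevance.
Qed.

Lemma induced_subproof (G : graph) (S : {fset nat})
    (E := [fset e in edges G | e `<=` S]) :
  [forall e : E, (fsval e `<=` vertices G `&` S) && (#|` fsval e| == 2)].
Proof.
apply/forallP => -[e /= eE]; move: eE; rewrite !inE /= => /andP[eG eS].
by have /andP[eV ->] := edgesP eG; rewrite fsubsetI eV eS.
Qed.

Definition induced (G : graph) (S : {fset nat}) : graph :=
  Graph (induced_subproof G S).

Definition delete_vertex (G : graph) (v : nat) : graph :=
  induced G (vertices G `\ v).

(** The second disjunct is the insertion of a new vertex [v] with arbitrary
    incident edges. *)
Definition node_step (G G' : graph) : Prop :=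
  (exists2 v, v \in vertices G & G' = delete_vertex G v) \/
  (exists2 v, v \in vertices G' & G = delete_vertex G' v).

Fixpoint node_walk (n : nat) (G G' : graph) : Prop :=
  if n is m.+1 then exists2 G1, node_step G G1 & node_walk m G1 G'
  else G = G'.

Lemma node_walk_cat m n G1 G2 G3 :
  node_walk m G1 G2 -> node_walk n G2 G3 -> node_walk (m + n)%N G1 G3.
Proof.
elim: m G1 => [|m IHm] G1 /=; first by move=> ->.
by move=> [G s w] w'; exists G => //; apply: IHm.
Qed.

Lemma node_step_sym G G' : node_step G G' -> node_step G' G.
Proof. by case=> ?; [right|left]. Qed.

Lemma node_walk_sym n G G' : node_walk n G G' -> node_walk n G' G.
Proof.
elim: n G => [|n IHn] G /=; first by move=> ->.
move=> [G1 s /IHn w].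
have w1 : node_walk 1 G1 G by exists G => //; apply: node_step_sym.
by have := node_walk_cat w w1; rewrite addn1.
Qed.

Lemma node_walk_empty G :
  exists n, exists2 G0, vertices G0 = fset0 & node_walk n G G0.
Proof.
have [k] := ubnP #|` vertices G|; elim: k G => // k IHk G leGk.
have [V0|[v vV]] := fset_0Vmem (vertices G).
  by exists 0, G.
have [|n [G0 V0 w]] := IHk (delete_vertex G v).
  rewrite ltnS in leGk; apply: leq_trans leGk => /=.
  apply: fproper_ltn_card; rewrite (fsetIidPr (fsubD1set _ _)).
  exact: fproperD1.
by exists n.+1, G0 => //; exists (delete_vertex G v) => //; left; exists v.
Qed.

Lemma node_walk_exists (G G' : graph) : exists n, `[< node_walk n G G' >].
Proof.
have [n [G0 V0 w]] := node_walk_empty G.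
have [n' [G0' V0' w']] := node_walk_empty G'.
suff eqG : G0 = G0'.
  by exists (n + n')%N; apply/asboolP/(node_walk_cat w)/node_walk_sym; rewrite eqG.
have E0 (K : graph) : vertices K = fset0 -> edges K = fset0.
  move=> VK; apply/fsetP => e; rewrite inE; apply/negP => /edgesP.
  by rewrite VK fsubset0 => /andP[/eqP ->]; rewrite cardfs0.
by apply: graph_eq; rewrite ?V0 ?V0' // !E0.
Qed.

Definition node_dist (G G' : graph) : nat := ex_minn (node_walk_exists G G').

Definition adjacent (F : {fset {fset nat}}) : rel nat :=
  [rel u v | [fset u; v] \in F].

Definition linked (F : {fset {fset nat}}) (u v : nat) : Prop :=
  exists2 p, path (adjacent F) u p & v = last u p.

Definition acyclic (F : {fset {fset nat}}) : Prop :=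
  forall c : seq nat, uniq c -> 2 < size c -> ~ cycle (adjacent F) c.

(** A forest in [G] with the same connected components as [G]; it is given by
    its edge set, its vertex set being that of [G]. *)
Definition spanning_forest (G : graph) (F : {fset {fset nat}}) : Prop :=
  [/\ F `<=` edges G, acyclic F &
      {in vertices G &, forall u v, linked F u v <-> linked (edges G) u v}].

(** All spanning forests of [G] have the same number of edges, so the maximum
    only serves to pick out this common value. *)
Definition sf_size (G : graph) : nat :=
  \max_(F <- fpowerset (edges G) | `[< spanning_forest G F >]) #|` F|.

Local Open Scope ring_scope.
Local Open Scope classical_set_scope.

Definition f_sf (R : realType) (G : graph) : R := (sf_size G)%:R.

Definition forest_polytope (R : realType) (Delta : R) (G : graph)
    : set (edges G -> R) :=
  [set x | [/\ forall e, 0 <= x e,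
      forall S : {fset nat}, (S `<=` vertices G)%fset -> (2 <= #|` S|)%N ->
        \sum_(e : edges G | (fsval e `<=` S)%fset) x e <= #|` S|%:R - 1
    & forall v : nat, v \in vertices G ->
        \sum_(e : edges G | v \in fsval e) x e <= Delta]].
Arguments forest_polytope {R} Delta G.

(** The polytope is compact and contains 0, so this supremum is a maximum. *)
Definition f_bounded (R : realType) (Delta : R) (G : graph) : R :=
  sup [set \sum_(e : edges G) x e | x in forest_polytope Delta G].

Definition Lipschitz (R : realType) (c : R) : set (graph -> R) :=
  [set h | forall G G', `|h G - h G'| <= c * (node_dist G G')%:R].

Definition Err (R : realType) (G : graph) (g f : graph -> R) : R :=
  \big[Num.max/0]_(S <- fpowerset (vertices G))
     `|g (induced G S) - f (induced G S)|.

Definition is_minimum (R : realType) (A : set R) (m : R) : Prop :=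
  A m /\ lbound A m.

(* Main.v *)
Require Import Defs.
From HB Require Import structures.
From mathcomp Require Import all_boot all_order all_algebra finmap.
From mathcomp Require Import boolp classical_sets reals.
From mathcomp Require Import topology normedtype derive lra.

Set Implicit Arguments.
Unset Strict Implicit.
Unset Printing Implicit Defensive.

Import Order.TTheory GRing.Theory Num.Theory.
Import numFieldNormedType.Exports.

Local Open Scope ring_scope.
Local Open Scope classical_set_scope.

(** By McShane extension, the optimal error [m] satisfies
    [2 m = max (f_sf H1 - f_sf H2 - (Delta - 1) d(H1, H2))] over induced subgraphs
    [H1], [H2] of [G].  So it suffices to find, for each induced [H] with
    [f_Delta H < f_sf H], a set [T] of vertices with
    [f_sf (H - T) + (Delta - 1) |T| + 1 <= f_Delta H].

    Among the optimal points [y] of the polytope choose one with the fewest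
    vertices of weighted degree exactly [Delta], and let [T] be the set of these.
    Call [S] tight if [y(E[S]) = |S| - 1].  An exchange argument shows that each
    edge of [H - T] lies in a tight set avoiding [T]; tight sets that meet have a
    tight union, so the maximal ones partition [V - T], and a forest of [H - T]
    has at most [y(E[V - T])] edges.  Hence [T] is nonempty, and
      [f_Delta H = y(E[V - T]) + Delta |T| - y(E[T])
                 >= f_sf (H - T) + Delta |T| - (|T| - 1)]. *)

(** * Spanning forests *)

Lemma adjacent_sym F : symmetric (adjacent F).
Proof. by move=> u v; rewrite /adjacent /= fsetUC. Qed.

Lemma linked_refl F u : linked F u u.
Proof. by exists [::]. Qed.

Lemma linked_trans F u v w : linked F u v -> linked F v w -> linked F u w.
Proof.
move=> [p pp ->] [q pq ->]; exists (p ++ q); last by rewrite last_cat.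
by rewrite cat_path pp.
Qed.

Lemma linked_sym F u v : linked F u v -> linked F v u.
Proof.
move=> [p pp ->]; exists (rev (belast u p)); last first.
  by case: p {pp} => //= x p; rewrite rev_cons last_rcons.
by rewrite rev_path (eq_path (e' := adjacent F)) // => x y; exact: adjacent_sym.
Qed.

Lemma linked1 F u v : [fset u; v]%fset \in F -> linked F u v.
Proof. by move=> uvF; exists [:: v] => //=; rewrite /adjacent /= uvF. Qed.

(** Serves as the induction principle for [linked]: a walk is consumed edge by edge. *)
Lemma linked_min F (r : nat -> nat -> Prop) :
  (forall u, r u u) -> (forall u v w, r u v -> r v w -> r u w) ->
  (forall u v, [fset u; v]%fset \in F -> r u v) ->
  forall u v, linked F u v -> r u v.
Proof.
move=> r0 rt rF u v [p + ->]; elim: p u => //= x p IHp u /andP[ux px].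
by apply: rt (IHp _ px); apply: rF.
Qed.

Lemma linked_sub F F' u v : (F `<=` F')%fset -> linked F u v -> linked F' u v.
Proof.
move=> /fsubsetP FF'; apply: linked_min; first exact: linked_refl.
  by move=> a b c; exact: linked_trans.
by move=> a b /FF'; exact: linked1.
Qed.

Lemma adjacent_sub F F' : (F `<=` F')%fset -> subrel (adjacent F) (adjacent F').
Proof. by move=> /fsubsetP FF' u v; apply: FF'. Qed.

Lemma acyclic_sub F F' : (F `<=` F')%fset -> acyclic F' -> acyclic F.
Proof.
move=> FF' aF' [|x c] uc sc cc; first by [].
by apply: (aF' (x :: c)) => //; apply: sub_path cc; exact: adjacent_sub.
Qed.

(** A walk in [F] shortens to a simple path. As the edge [[fset u; v]] is not in [F], this path has
    at least three vertices, and the edge closes it to a cycle. *)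
Lemma acyclic_not_linked F u v : u != v -> [fset u; v]%fset \notin F ->
  acyclic ([fset u; v] |` F)%fset -> ~ linked F u v.
Proof.
move=> uv uvF aF [p pp vE].
case: (shortenP pp) vE => q pq uq _ vE.
apply: (aF (u :: q)) => //.
  case: q pq vE {uq} => [|a [|b q]] //=; first by move=> _ vE; rewrite vE eqxx in uv.
  by rewrite /adjacent /= andbT => + va; rewrite -va (negPf uvF).
rewrite /cycle rcons_path -vE; apply/andP; split.
  by apply: sub_path pq; apply: adjacent_sub; rewrite fsubsetU // fsubset_refl orbT.
by rewrite /adjacent /= fsetUC fset1U1.
Qed.

Lemma path_avoid F a b x p : a \notin x :: p ->
  path (adjacent F) x p -> path (adjacent (F `\ [fset a; b])%fset) x p.
Proof.
elim: p x => //= y p IHp x; rewrite !inE !negb_or => /and3P[ax ay ap].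
rewrite /adjacent /= => /andP[xyF py]; rewrite IHp ?inE ?negb_or ?ay // xyF !andbT.
apply: contraNneq ax => E; have : a \in [fset x; y]%fset by rewrite E fset21.
by rewrite !inE (negPf ay) orbF.
Qed.

(** An edge of a cycle is redundant for connectivity: the way round the other side starts with a
    different edge at [a] and never returns to [a]. *)
Lemma cycle_linked F a y q : q != [::] -> uniq [:: a, y & q] ->
  path (adjacent F) a (y :: q) ->
  linked (F `\ [fset a; last y q])%fset a (last y q).
Proof.
move=> q0 /= /and3P[ayq yq _] /andP[]; rewrite {1}/adjacent /= => ayF pyq.
exists (y :: q) => //=; rewrite path_avoid // andbT /adjacent /= !inE ayF andbT.
apply/eqP => E; have : y \in [fset a; last y q]%fset by rewrite -E fset22.
rewrite !inE => /orP[/eqP ya|/eqP yl]; first by rewrite ya mem_head in ayq.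
by case: q q0 yq yl {ayq pyq E} => //= z q _ + yl; rewrite {1}yl mem_last.
Qed.

(** Take the fewest edges that preserve connectivity; a cycle would contain an edge that can still
    be dropped. *)
Lemma spanning_forest_exists G : exists F, spanning_forest G F.
Proof.
pose P F := (F `<=` edges G)%fset /\
  forall u v, linked F u v <-> linked (edges G) u v.
have exP : exists n, `[< exists2 F, P F & #|` F| = n >].
  by exists #|` edges G|; apply/asboolP; exists (edges G).
case: (ex_minnP exP) => n /asboolP[F [FE FL] Fn] minF; exists F; split=> //.
move=> [|a [|y q]] // uc sc cc.
have q0 : q != [::] by case: (q) sc.
move: cc; rewrite /cycle rcons_path => /andP[pq]; rewrite /adjacent /= fsetUC => laF.
have lkn := cycle_linked q0 uc pq.
have /minF : `[< exists2 F', P F' & #|` F'| = #|` (F `\ [fset a; last y q])%fset| >].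
  apply/asboolP; exists (F `\ [fset a; last y q])%fset => //; split.
    exact: fsubset_trans (fsubD1set _ _) FE.
  move=> u v; split=> [|/FL]; first by move/(linked_sub (fsubD1set _ _))/FL.
  move: u v; apply: linked_min; first exact: linked_refl.
    by move=> ? ? ?; exact: linked_trans.
  move=> u v uvF; have [E|nE] := eqVneq [fset u; v]%fset [fset a; last y q]%fset.
    have uE : u \in [fset a; last y q]%fset by rewrite -E fset21.
    have vE : v \in [fset a; last y q]%fset by rewrite -E fset22.
    move: uE vE; rewrite !inE => /orP[]/eqP-> /orP[]/eqP->;
      by [exact: linked_refl|exact: lkn|exact: linked_sym lkn].
  by apply: linked1; rewrite !inE nE.
by rewrite leqNgt -Fn (cardfsD1 [fset a; last y q]%fset F) laF add1n ltnSn.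
Qed.

Lemma cardfs2_pair (T : choiceType) (e : {fset T}) : #|` e| = 2 ->
  exists u v, u != v /\ e = [fset u; v]%fset.
Proof.
move=> e2; have [e0|[u ue]] := fset_0Vmem e; first by rewrite e0 cardfs0 in e2.
have := cardfsD1 u e; rewrite ue e2 => -[/esym/eqP/cardfs1P[v eD]].
exists u, v; rewrite -(fsetD1K ue) eD; split=> //.
by have := fset11 v; rewrite -eD !inE eq_sym => /andP[].
Qed.

(** The labels name the connected components, so the count says that edges plus components equal
    vertices. Induction on the edges: each edge joins two components of the remaining forest. *)
Lemma forest_labelling (V : {fset nat}) (F : {fset {fset nat}}) :
  acyclic F -> (forall e, e \in F -> (e `<=` V)%fset /\ #|` e| = 2) ->
  exists c : nat -> nat, (forall u v, linked F u v <-> c u = c v) /\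
    (#|` F| + #|` [fset c v | v in V]%fset|)%N = #|` V|.
Proof.
have [n] := ubnP #|` F|; elim: n F => // n IHn F Fn aF FV.
have [->|[e eF]] := fset_0Vmem F.
  exists id; split; last by rewrite cardfs0 card_imfset.
  move=> u v; split=> [|->]; last exact: linked_refl.
  move: u v; apply: linked_min => [//|? ? ? -> //|u v]; by rewrite inE.
pose F' := (F `\ e)%fset.
have FE : F = (e |` F')%fset by rewrite fsetD1K.
have eF' : e \notin F' by rewrite !inE eqxx.
have [eV e2] := FV e eF.
have [u [v [uv eE]]] := cardfs2_pair e2.
have sF' : (F' `<=` F)%fset := fsubD1set _ _.
have aF' := acyclic_sub sF' aF.
have [|||c [cL cV]] := IHn F'.
- by move: Fn; rewrite (cardfsD1 e F) eF add1n ltnS.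
- exact: aF'.
- by move=> f /(fsubsetP sF'); exact: FV.
have ncuv : c u <> c v.
  by move/cL; apply: acyclic_not_linked => //; rewrite -eE // -FE.
(* Merge the component of [u] into that of [v]: exactly the label [c u] disappears, which balances
   the edge put back. *)
exists (fun w => if c w == c u then c v else c w); split; last first.
  have [uV vV] : u \in V /\ v \in V.
    by split; apply: (fsubsetP eV); rewrite eE ?fset21 ?fset22.
  rewrite FE cardfsU1 eF' -cV -addnA addnCA; congr (_ + _)%N.
  rewrite (cardfsD1 (c u) [fset c v | v in V]%fset) in_imfset //= ?add1n.
  congr (1 + #|` _|)%N; apply/fsetP => x; rewrite !inE.
  apply/imfsetP/andP => /=.
    move=> [w wV ->]; case: ifPn => [_|nw]; last by rewrite in_imfset.
    by rewrite in_imfset // eq_sym; split=> //; apply/eqP.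
  move=> [xu /imfsetP[w /= wV xE]]; exists w => //.
  by rewrite -xE (negPf xu).
have luv : linked F u v by apply: linked1; rewrite -eE.
move=> a b; split.
  move: a b; apply: linked_min => [//|? ? ? -> //|a b]; rewrite FE in_fset1U => /orP[/eqP abE|abF].
    have aE : a \in [fset u; v]%fset by rewrite -eE -abE fset21.
    have bE : b \in [fset u; v]%fset by rewrite -eE -abE fset22.
    move: aE bE; rewrite !inE => /orP[]/eqP-> /orP[]/eqP->; rewrite ?eqxx //;
      by case: ifP.
  by have /cL-> := linked1 abF.
have sL x y : c x = c y -> linked F x y by move/cL; exact: linked_sub.
case: eqP => au; case: eqP => bu.
- by move=> _; apply: sL; rewrite au.
- by move/sL; apply: linked_trans; apply: linked_trans (sL _ _ au) luv.
- by move/sL/linked_trans; apply; apply: linked_sym; apply: linked_trans (sL _ _ bu) luv.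
- exact: sL.
Qed.

(** * Fractional forests and tight sets *)

Definition inner_weight (R : realType) (H : graph) (y : {fset nat} -> R)
    (S : {fset nat}) : R :=
  \sum_(e <- edges H | (e `<=` S)%fset) y e.

Definition degree_weight (R : realType) (H : graph) (y : {fset nat} -> R)
    (v : nat) : R :=
  \sum_(e <- edges H | v \in e) y e.

(* [forest_polytope] for weights defined on all sets of vertices; the values
   outside [edges H] are irrelevant, and singletons [S] add no constraint. *)
Definition fractional_forest (R : realType) (Delta : R) (H : graph)
    (y : {fset nat} -> R) : Prop :=
  [/\ forall e, e \in edges H -> 0 <= y e,
      forall S, (S `<=` vertices H)%fset -> S != fset0 ->
        inner_weight H y S <= #|` S|%:R - 1
    & forall v, v \in vertices H -> degree_weight H y v <= Delta].

Definition tight (R : realType) (H : graph) (y : {fset nat} -> R)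
    (S : {fset nat}) : Prop :=
  [/\ (S `<=` vertices H)%fset, S != fset0 & inner_weight H y S = #|` S|%:R - 1].

Lemma edge_sub (H : graph) e : e \in edges H -> (e `<=` vertices H)%fset.
Proof. by move=> /edgesP/andP[]. Qed.

Lemma edge_card (H : graph) e : e \in edges H -> #|` e| = 2.
Proof. by move=> /edgesP/andP[_ /eqP]. Qed.

Lemma edge_pair (H : graph) e : e \in edges H ->
  exists u v, [/\ u != v, e = [fset u; v]%fset,
    u \in vertices H & v \in vertices H].
Proof.
move=> eH; have [u [v [uv eE]]] := cardfs2_pair (edge_card eH).
by exists u, v; split=> //; apply: (fsubsetP (edge_sub eH)); rewrite eE ?fset21 ?fset22.
Qed.

Lemma inner_weight1 (R : realType) (H : graph) (y : {fset nat} -> R) v :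
  inner_weight H y [fset v]%fset = 0.
Proof.
rewrite /inner_weight big_seq_cond big1 // => e /andP[/edge_card e2].
by move=> /fsubset_leq_card; rewrite e2 cardfs1.
Qed.

Lemma tight1 (R : realType) (H : graph) (y : {fset nat} -> R) v :
  v \in vertices H -> tight H y [fset v]%fset.
Proof.
move=> vH; split; first by rewrite fsub1set.
  by apply/fset0Pn; exists v; rewrite inE.
by rewrite inner_weight1 cardfs1 subrr.
Qed.

(** The fibres of [c] partition [U], and a nonempty edge on which [c] is constant lies inside
    exactly one of them. *)
Lemma block_sum (R : realType) (K : choiceType) (D : {fset {fset nat}})
    (U : {fset nat}) (c : nat -> K) (y : {fset nat} -> R) :
  (forall e, e \in D -> [/\ (e `<=` U)%fset, e != fset0 &
    {in e &, forall u v, c u = c v}]) ->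
  \sum_(e <- D) y e =
  \sum_(b <- [fset c v | v in U]%fset)
    \sum_(e <- D | (e `<=` [fset v in U | c v == b])%fset) y e.
Proof.
move=> Dc; under [RHS]eq_bigr do rewrite big_mkcond.
rewrite exchange_big /= big_seq [RHS]big_seq; apply: eq_bigr => e /Dc[eU e0 ec].
have [u ue] := fset0Pn _ e0.
rewrite (big_fsetD1 (c u)) /=; last by rewrite in_imfset //=; apply: (fsubsetP eU).
rewrite ifT ?big_seq ?big1 ?addr0 //; last first.
  apply/fsubsetP => v ve; rewrite !inE /= (fsubsetP eU) //=.
  by apply/eqP/ec.
move=> b; rewrite !inE => /andP[bu _]; case: ifP => // /fsubsetP/(_ u ue).
by rewrite !inE /= eq_sym (negPf bu) andbF.
Qed.

Lemma block_card (R : realType) (K : choiceType) (U : {fset nat}) (c : nat -> K) :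
  \sum_(b <- [fset c v | v in U]%fset)
     (#|` [fset v in U | c v == b]%fset|%:R - 1 : R) =
  #|` U|%:R - #|` [fset c v | v in U]%fset|%:R.
Proof.
rewrite sumrB (card_fset_sum1 [fset c v | v in U]%fset) natr_sum; congr (_ - _).
rewrite -natr_sum [in RHS]card_fset_sum1 (partition_big_imfset _ c) /=; congr _%:R.
by apply: eq_bigr => b _; rewrite card_fset_sum1 big_fset.
Qed.

Lemma block_neq0 (K : choiceType) (U : {fset nat}) (c : nat -> K) b :
  b \in [fset c v | v in U]%fset -> [fset v in U | c v == b]%fset != fset0.
Proof.
move=> /imfsetP[v /= vU ->]; apply/fset0Pn; exists v.
by rewrite !inE /= vU eqxx.
Qed.

(** A nonempty vertex set has at least one component. *)
Lemma acyclic_card (F : {fset {fset nat}}) (S : {fset nat}) : acyclic F ->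
  (forall e, e \in F -> (e `<=` S)%fset /\ #|` e| = 2) -> S != fset0 ->
  (#|` F| < #|` S|)%N.
Proof.
move=> aF FS /fset0Pn[v vS]; have [c [_ <-]] := forest_labelling aF FS.
rewrite -addn1 leq_add2l cardfs_gt0; apply/fset0Pn.
by exists (c v); rewrite in_imfset.
Qed.

Lemma spanning_forest_card (H : graph) F :
  spanning_forest H F -> (#|` F| <= sf_size H)%N.
Proof.
move=> sF; rewrite /sf_size.
rewrite (big_rem F) /=; last by rewrite fpowersetE; case: sF.
by rewrite ifT ?leq_maxl //; apply/asboolP.
Qed.

(** Every edge lies within a component of a spanning forest. The subset constraints on the
    components add up to vertices minus components, the size of that forest. *)
Lemma fractional_forest_le (R : realType) (Delta : R) (H : graph) y :
  fractional_forest Delta H y -> \sum_(e <- edges H) y e <= f_sf R H.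
Proof.
move=> [y0 yS _]; have [F sF] := spanning_forest_exists H.
apply: (@le_trans _ _ #|` F|%:R); last by rewrite ler_nat spanning_forest_card.
have [FE aF FL] := sF.
have [e /(fsubsetP FE) eH|c [cL cV]] := @forest_labelling (vertices H) F aF.
  by split; [exact: edge_sub eH|exact: edge_card eH].
rewrite (@block_sum _ _ _ (vertices H) c); last first.
  move=> e eH; have [u [v [uv eE uH vH]]] := edge_pair eH; split.
  - exact: edge_sub eH.
  - by apply/fset0Pn; exists u; rewrite eE fset21.
  - have cuv : c u = c v by apply/cL/FL => //; apply: linked1; rewrite -eE.
    by move=> a b; rewrite eE !inE => /orP[]/eqP-> /orP[]/eqP->.
have -> : #|` F|%:R = #|` vertices H|%:R - #|` [fset c v | v in vertices H]%fset|%:R :> R.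
  by rewrite -cV natrD addrK.
rewrite -block_card big_seq [leRHS]big_seq; apply: ler_sum => b bc.
apply: yS; last exact: block_neq0.
by apply/fsubsetP => v; rewrite !inE /= => /andP[].
Qed.

(** Edge by edge: an edge inside [A] or [B] is inside the union, and one inside both is also inside
    the intersection. *)
Lemma inner_weight_supermodular (R : realType) (H : graph) (y : {fset nat} -> R) A B :
  (forall e, e \in edges H -> 0 <= y e) ->
  inner_weight H y A + inner_weight H y B <=
  inner_weight H y (A `|` B)%fset + inner_weight H y (A `&` B)%fset.
Proof.
move=> y0.
have iwE S : inner_weight H y S = \sum_(e <- edges H) if (e `<=` S)%fset then y e else 0.
  by rewrite /inner_weight big_mkcond.
rewrite !iwE -!big_split /=.
rewrite big_seq [leRHS]big_seq; apply: ler_sum => e /y0 ye; rewrite fsubsetI.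
have [eA|_] := boolP (e `<=` A)%fset; have [eB|_] := boolP (e `<=` B)%fset => //=.
- by rewrite fsubsetU ?eA.
- by rewrite fsubsetU ?eA // addr0.
- by rewrite fsubsetU ?eB ?orbT // !(addr0, add0r).
- by case: ifP; rewrite ?addr0.
Qed.

(** Uncrossing: by supermodularity the weights of union and intersection sum to at least the sum of
    their two upper bounds, so both bounds are attained. *)
Lemma tight_meet (R : realType) (Delta : R) (H : graph) y A B :
  fractional_forest Delta H y -> tight H y A -> tight H y B ->
  (A `&` B)%fset != fset0 ->
  tight H y (A `|` B)%fset /\ tight H y (A `&` B)%fset.
Proof.
move=> [y0 yS _] [AH A0 yA] [BH B0 yB] AB0.
have UH : (A `|` B `<=` vertices H)%fset by rewrite fsubUset AH.
have IH : (A `&` B `<=` vertices H)%fset := fsubset_trans (fsubsetIl _ _) AH.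
have U0 : (A `|` B)%fset != fset0.
  by move: A0 => /fset0Pn[a aA]; apply/fset0Pn; exists a; rewrite !inE aA.
have := inner_weight_supermodular A B y0.
have := yS _ UH U0; have := yS _ IH AB0.
have : #|` (A `|` B)%fset|%:R + #|` (A `&` B)%fset|%:R = #|` A|%:R + #|` B|%:R :> R.
  by rewrite -!natrD cardfsUI.
by rewrite yA yB => h1 h2 h3 h4; split; split=> //; lra.
Qed.

(** Take [M] of largest size. Any other tight set through [v] meets it in [v], so the union is tight
    and cannot be larger than [M]. *)
Lemma maximal_tight (R : realType) (Delta : R) (H : graph) y U v :
  fractional_forest Delta H y -> (U `<=` vertices H)%fset -> v \in U ->
  exists2 M, [/\ tight H y M, (M `<=` U)%fset & v \in M] &
    forall S, tight H y S -> (S `<=` U)%fset -> v \in S -> (S `<=` M)%fset.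
Proof.
move=> fy UH vU.
pose P M := [/\ tight H y M, (M `<=` U)%fset & v \in M].
have exP : exists n, `[< exists2 M, P M & #|` M| = n >].
  exists 1%N; apply/asboolP; exists [fset v]%fset; last by rewrite cardfs1.
  split; rewrite ?fsub1set ?inE //; apply: tight1; exact: (fsubsetP UH).
have ubP n : `[< exists2 M, P M & #|` M| = n >] -> (n <= #|` U|)%N.
  by move=> /asboolP[M [_ MU _] <-]; exact: fsubset_leq_card.
case: (ex_maxnP exP ubP) => n /asboolP[M [tM MU vM] Mn] maxM.
exists M => // S tS SU vS.
have [|tSM _] := tight_meet fy tS tM.
  by apply/fset0Pn; exists v; rewrite inE vS.
have /maxM : `[< exists2 M', P M' & #|` M'| = #|` (S `|` M)%fset| >].
  apply/asboolP; exists (S `|` M)%fset => //; split => //.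
    by rewrite fsubUset SU.
  by rewrite inE vS.
rewrite -Mn => le; have /fsubset_cardP : #|` M| = #|` (S `|` M)%fset|.
  by apply/eqP; rewrite eqn_leq le andbT fsubset_leq_card // fsubsetUr.
by move=> /(_ (fsubsetUr _ _))/fsetP ->; exact: fsubsetUl.
Qed.

(* The maximal tight sets inside [U] partition [U], and a forest of the induced
   graph has at most [#|B| - 1] edges inside each of them. *)
Lemma tight_cover_le (R : realType) (Delta : R) (H : graph) y U :
  fractional_forest Delta H y -> (U `<=` vertices H)%fset ->
  (forall e, e \in edges H -> (e `<=` U)%fset ->
     exists S, [/\ tight H y S, (e `<=` S)%fset & (S `<=` U)%fset]) ->
  f_sf R (induced H U) <= inner_weight H y U.
Proof.
move=> fy UH cov; have [y0 yS _] := fy.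
have /choice[M MP] : forall v, exists M, v \in U ->
   [/\ tight H y M, (M `<=` U)%fset & v \in M] /\
    forall S, tight H y S -> (S `<=` U)%fset -> v \in S -> (S `<=` M)%fset.
  move=> v; have [vU|_] := boolP (v \in U); last by exists fset0.
  by have [M] := maximal_tight fy UH vU; exists M.
(* [M] is constant on each of its values, hence usable as the labelling in [block_sum]. *)
have MM v w : v \in U -> w \in M v -> M w = M v.
  move=> vU wM; have [[tM MU vM] maxM] := MP v vU.
  have wU := fsubsetP MU _ wM; have [[tW WU wW] maxW] := MP w wU.
  have MW := maxW _ tM MU wM.
  by apply/eqP; rewrite eqEfsubset MW andbT maxM // (fsubsetP MW).
(* The labels are the blocks themselves: the fibre over [b] is [b]. *)
have blockE b : b \in [fset M v | v in U]%fset ->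
    tight H y b /\ [fset v in U | M v == b]%fset = b.
  move=> /imfsetP[v /= vU ->]; have [[tM MU vM] _] := MP v vU; split=> //.
  apply/fsetP => w; rewrite !inE /=; apply/andP/idP => [[wU /eqP <-]|wM].
    by have [[]] := MP w wU.
  by rewrite (fsubsetP MU) // (MM v w) // eqxx.
have mono e : e \in edges H -> (e `<=` U)%fset ->
    [/\ (e `<=` U)%fset, e != fset0 & {in e &, forall u v, M u = M v}].
  move=> eH eU; split => //.
    by have [u [v [_ -> _ _]]] := edge_pair eH; apply/fset0Pn; exists u; rewrite fset21.
  have [S [tS eS SU]] := cov e eH eU; move=> u v ue ve.
  have uU := fsubsetP eU _ ue; have [_ maxM] := MP u uU.
  by rewrite (MM u v) //; apply: (fsubsetP (maxM _ tS SU (fsubsetP eS _ ue))); apply: (fsubsetP eS).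
pose D := [fset e in edges H | (e `<=` U)%fset]%fset.
have DP e : e \in D -> e \in edges H /\ (e `<=` U)%fset.
  by rewrite !inE /= => /andP[].
have -> : inner_weight H y U = #|` U|%:R - #|` [fset M v | v in U]%fset|%:R.
  have -> : inner_weight H y U = \sum_(e <- D) y e.
    by rewrite big_fset.
  rewrite (@block_sum _ _ _ U M); last by move=> e /DP[]; exact: mono.
  rewrite -block_card big_seq [RHS]big_seq; apply: eq_bigr => b bM.
  have [[bH b0 wb] bE] := blockE b bM.
  rewrite !bE -wb big_mkcond big_fset /= -big_mkcondr; apply: eq_bigl => e.
  rewrite andb_idl // => /fsubset_trans; apply.
  by rewrite -bE; apply/fsubsetP => v; rewrite !inE /= => /andP[].
rewrite -block_card /f_sf /sf_size.
(* [sf_size] is a maximum, so the bound is checked for the initial value 0, for the maximum of two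
   numbers, and for each forest. *)
apply: (big_ind (fun n : nat => n%:R <= _)) => [|m n hm hn|F].
- rewrite big_seq; apply: sumr_ge0 => b /block_neq0.
  by rewrite -cardfs_gt0 subr_ge0 ler1n.
- by rewrite /maxn; case: ifP.
move=> /asboolP[FE aF _]; have FD e : e \in F -> e \in D by apply: (fsubsetP FE).
rewrite (card_fset_sum1 F) natr_sum (@block_sum _ _ F U M); last first.
  by move=> e eF; have [] := DP e (FD e eF); exact: mono.
rewrite big_seq [leRHS]big_seq; apply: ler_sum => b bM.
have [_ bE] := blockE b bM; rewrite !bE.
have -> : \sum_(e <- F | (e `<=` b)%fset) 1%:R =
    #|` [fset e in F | (e `<=` b)%fset]%fset|%:R :> R.
  by rewrite card_fset_sum1 natr_sum big_fset.
rewrite lerBrDr natr1 ler_nat.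
apply: acyclic_card.
- by apply: acyclic_sub aF; apply/fsubsetP => e; rewrite !inE /= => /andP[].
- by move=> e; rewrite !inE /= => /andP[eF eb]; have [/edge_card] := DP e (FD e eF).
- by rewrite -bE block_neq0.
Qed.

(** * Existence of an optimal fractional forest *)

Lemma polytope_fractional_forest (R : realType) (Delta : R) (H : graph)
    (y : {fset nat} -> R) :
  forest_polytope Delta H (fun e => y (fsval e)) <-> fractional_forest Delta H y.
Proof.
split=> [[y0 yS yD]|[y0 yS yD]]; split.
- by move=> e eH; exact: (y0 [` eH]%fset).
(* A singleton contains no edge and its bound is 1 - 1, so its constraint holds trivially. *)
- move=> S SH S0; have [S1|] := leqP #|` S| 1.
    have /cardfs1P[v ->] : #|` S| == 1%N by rewrite eqn_leq S1 cardfs_gt0.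
    by rewrite inner_weight1 cardfs1 subrr.
  by rewrite /inner_weight big_seq_fsetE; exact: yS.
- by move=> v vH; rewrite /degree_weight big_seq_fsetE; exact: yD.
- by move=> e; apply: y0; exact: fsvalP.
- move=> S SH S2; rewrite -(big_seq_fsetE _ _ (fun e : {fset nat} => e `<=` S)%fset y); apply: yS => //.
  by rewrite -cardfs_gt0; exact: ltnW.
- by move=> v vH; rewrite -(big_seq_fsetE _ _ (fun e : {fset nat} => v \in e) y); exact: yD.
Qed.

Lemma continuous_sum_eval (R : realType) (I : finType) (P : pred I) :
  continuous (fun x : {ptws I -> R} => \sum_(i | P i) x i : R).
Proof.
elim: (index_enum I) => [|i r IHr] x.
  have -> : (fun x : {ptws I -> R} => \sum_(j <- [::] | P j) x j : R) = (fun=> 0).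
    by apply/funext => z; rewrite big_nil.
  exact: cst_continuous.
have [Pi|Pi] := boolP (P i).
  have -> : (fun x : {ptws I -> R} => \sum_(j <- i :: r | P j) x j : R) =
      (fun x => x i + \sum_(j <- r | P j) x j).
    by apply/funext => z; rewrite big_cons Pi.
  apply: (@continuousD _ R _ (fun x : {ptws I -> R} => x i : R)); last exact: IHr.
  exact: (@proj_continuous I (fun _ => R) i).
have -> : (fun x : {ptws I -> R} => \sum_(j <- i :: r | P j) x j : R) =
    (fun x => \sum_(j <- r | P j) x j).
  by apply/funext => z; rewrite big_cons (negPf Pi).
exact: IHr.
Qed.

Lemma closed_sum_le (R : realType) (I : finType) (P : pred I) (b : R) :
  closed ([set x | \sum_(i | P i) x i <= b] : set {ptws I -> R}).
Proof.
pose f (x : {ptws I -> R}) : R := \sum_(i | P i) x i.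
change (closed (f @^-1` [set r : R | r <= b])).
apply: closed_comp; last exact: closed_le.
by move=> x _; exact: continuous_sum_eval.
Qed.

Lemma edge_weight_le1 (R : realType) (Delta : R) (H : graph) x e :
  forest_polytope Delta H x -> x e <= 1.
Proof.
move=> [x0 xS _]; have eH := fsvalP e.
have := xS _ (edge_sub eH); rewrite (edge_card eH) => /(_ isT).
rewrite (bigD1 e) //= => h; have : x e <= 2 - 1.
  by apply: le_trans h; rewrite lerDl sumr_ge0.
by lra.
Qed.

(** The subset constraint at an edge bounds its weight by 1, so the polytope lies in a cube, compact
    by Tychonoff. It is closed because finite coordinate sums are continuous. *)
Lemma compact_forest_polytope (R : realType) (Delta : R) (H : graph) :
  compact (forest_polytope Delta H : set {ptws edges H -> R}).
Proof.
have cB : compact ([set x | forall e, `[0, 1]%classic (x e)] : set {ptws edges H -> R}).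
  apply: (@tychonoff _ (fun _ : edges H => R) (fun _ => `[0, 1]%classic)) => e.
  exact: segment_compact.
apply: subclosed_compact cB _; last first.
  move=> x fx e /=; rewrite in_itv /= (edge_weight_le1 _ fx) andbT.
  by case: fx.
have -> : (forest_polytope Delta H : set {ptws edges H -> R}) =
   \bigcap_e [set x : {ptws edges H -> R} | 0 <= x e] `&`
   (\bigcap_(S in [set S | (S `<=` vertices H)%fset /\ (2 <= #|` S|)%N])
     [set x : {ptws edges H -> R} | \sum_(e : edges H | (fsval e `<=` S)%fset) x e <= #|` S|%:R - 1] `&`
    \bigcap_(v in [set v | v \in vertices H])
     [set x : {ptws edges H -> R} | \sum_(e : edges H | v \in fsval e) x e <= Delta]).
  apply/seteqP; split=> x; last first.
    by move=> [x0 [xS xD]]; split=> [e|S SH S2|v vH]; [exact: x0|exact: xS|exact: xD].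
  move=> [x0 xS xD]; split=> [e _|]; first exact: x0.
  by split=> [S [SH S2]|v vH]; [exact: xS|exact: xD].
apply: closedI; [|apply: closedI]; apply: closed_bigI => i _; try exact: closed_sum_le.
change (closed ((fun x : {ptws edges H -> R} => x i : R) @^-1` [set r : R | 0 <= r])).
apply: closed_comp; last exact: closed_ge.
by move=> x _; exact: (@proj_continuous (edges H) (fun _ => R) i).
Qed.

Lemma f_bounded_attained (R : realType) (Delta : R) (H : graph) : 0 <= Delta ->
  exists2 y, fractional_forest Delta H y &
    f_bounded Delta H = \sum_(e <- edges H) y e /\
    forall z, fractional_forest Delta H z ->
      \sum_(e <- edges H) z e <= \sum_(e <- edges H) y e.
Proof.
move=> D0; pose A : set {ptws edges H -> R} := forest_polytope Delta H.
have A0 : A !=set0.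
  exists (fun _ => 0); split=> // [S _ S2|v _]; rewrite big1 //.
  by rewrite subr_ge0 ler1n ltnW.
have [|x xA xmax] := compact_EVT_max A0 (@compact_forest_polytope R Delta H)
  (f := fun x : {ptws edges H -> R} => \sum_(e : edges H) x e).
  by apply: continuous_subspaceT; exact: continuous_sum_eval.
rewrite inE in xA.
(* Extend the maximizer by 0 outside the edge set. *)
pose y e := if insub e is Some e' then x e' else 0.
have yE e : y (fsval e) = x e by rewrite /y valK.
have yx : (fun e : edges H => y (fsval e)) = x by exact/funext.
have sE : \sum_(e <- edges H) y e = \sum_(e : edges H) x e.
  by rewrite big_seq_fsetE; apply: eq_bigr => e _; exact: yE.
exists y; first by apply/polytope_fractional_forest; rewrite yx.
rewrite sE; split.
  apply/eqP; rewrite eq_le; apply/andP; split.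
    apply: ge_sup; first by case: A0 => z Az; exists (\sum_e z e), z.
    by move=> _ [z Az <-]; apply: xmax; rewrite inE.
  apply: ub_le_sup; last by exists x.
  exists (\sum_e x e) => _ [z Az <-]; apply: xmax; by rewrite inE.
move=> z /polytope_fractional_forest fz; rewrite big_seq_fsetE.
by apply: (xmax (fun e => z (fsval e))); rewrite inE.
Qed.

(** * The exchange argument *)

(** Along the direction [p], equalities survive by the sign of the slope and strict inequalities by
    a small enough step; finitely many of them share one step size. *)
Lemma small_perturbation (R : realType) (I : eqType) (s : seq I) (a b p : I -> R) :
  (forall i, i \in s -> a i <= b i) ->
  (forall i, i \in s -> a i = b i -> p i <= 0) ->
  exists2 d, 0 < d & forall t, 0 < t -> t <= d -> forall i, i \in s ->
    a i + t * p i <= b i /\ (a i < b i -> a i + t * p i < b i).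
Proof.
elim: s => [|i s IHs] ab abp; first by exists 1.
have [||d d0 dP] := IHs.
- by move=> j js; apply: ab; rewrite inE js orbT.
- by move=> j js; apply: abp; rewrite inE js orbT.
have is_ : i \in i :: s by rewrite mem_head.
have [abi|] := eqVneq (a i) (b i).
  exists d => // t t0 td j; rewrite inE => /orP[/eqP->|]; last exact: dP.
  by rewrite abi ltxx gerDl pmulr_rle0 //; split=> //; exact: abp.
move=> nab; have lab : a i < b i by rewrite lt_neqAle nab ab.
have p0 : 0 < `|p i| + 1 by rewrite ltr_wpDl.
(* The [+ 1] keeps the denominator positive and makes the resulting inequality strict. *)
pose d' := (b i - a i) / (`|p i| + 1).
have d'0 : 0 < d' by rewrite divr_gt0 // subr_gt0.
exists (Num.min d d'); first by rewrite lt_min d0.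
move=> t t0; rewrite le_min => /andP[td td'] j; rewrite inE => /orP[/eqP->|]; last exact: dP.
suff h : a i + t * p i < b i by split=> //; exact: ltW.
have h1 : t * (`|p i| + 1) <= b i - a i by rewrite -ler_pdivlMr.
have h2 : t * p i <= t * `|p i| by rewrite ler_pM2l // ler_norm.
by lra.
Qed.

Lemma sum_indicator (R : realType) (T : choiceType) (A : {fset T}) (P : pred T) a :
  \sum_(x <- A | P x) (x == a)%:R = ((a \in A) && P a)%:R :> R.
Proof.
rewrite big_mkcond; have [aA|aA] /= := boolP (a \in A).
  rewrite (big_fsetD1 a) //= eqxx big_seq big1 ?addr0; first by case: (P a).
  by move=> x; rewrite !inE => /andP[/negPf->]; case: ifP.
rewrite big_seq big1 // => x xA; case: ifP => // _; case: eqP => // xa.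
by rewrite -xa xA in aA.
Qed.

Lemma inner_weight_lin (R : realType) (H : graph) (y p : {fset nat} -> R) t S :
  inner_weight H (fun e => y e + t * p e) S =
  inner_weight H y S + t * inner_weight H p S.
Proof. by rewrite /inner_weight big_split /= mulr_sumr. Qed.

Lemma degree_weight_lin (R : realType) (H : graph) (y p : {fset nat} -> R) t v :
  degree_weight H (fun e => y e + t * p e) v =
  degree_weight H y v + t * degree_weight H p v.
Proof. by rewrite /degree_weight big_split /= mulr_sumr. Qed.

(** Feasible directions: the sign of [p] matters only at constraints active at [y]. Slack degrees
    stay slack, so no new tight vertices arise. *)
Lemma fractional_forest_perturb (R : realType) (Delta : R) (H : graph)
    (y p : {fset nat} -> R) :
  fractional_forest Delta H y ->
  (forall e, e \in edges H -> y e = 0 -> 0 <= p e) ->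
  (forall S, tight H y S -> inner_weight H p S <= 0) ->
  (forall v, v \in vertices H -> degree_weight H y v = Delta ->
     degree_weight H p v <= 0) ->
  exists t, [/\ 0 < t, fractional_forest Delta H (fun e => y e + t * p e) &
    forall v, v \in vertices H -> degree_weight H y v < Delta ->
      degree_weight H y v + t * degree_weight H p v < Delta].
Proof.
move=> [y0 yS yD] p0 pS pD.
(* Nonnegativity enters as [- y e <= 0], with direction [- p e]. *)
have [||d1 d10 d1P] := @small_perturbation R _ (edges H) (fun e => - y e) (fun=> 0)
    (fun e => - p e).
- by move=> e eH; rewrite oppr_le0 y0.
- by move=> e eH /eqP; rewrite oppr_eq0 => /eqP ye; rewrite oppr_le0 p0.
have [||d2 d20 d2P] := @small_perturbation R _
    [seq S <- fpowerset (vertices H) | S != fset0] (inner_weight H y)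
    (fun S => #|` S|%:R - 1) (inner_weight H p).
- by move=> S; rewrite mem_filter fpowersetE => /andP[S0 SH]; exact: yS.
- by move=> S; rewrite mem_filter fpowersetE => /andP[S0 SH] ?; exact: pS.
have [||d3 d30 d3P] := @small_perturbation R _ (vertices H) (degree_weight H y)
    (fun=> Delta) (degree_weight H p).
- by move=> v; exact: yD.
- by move=> v; exact: pD.
pose t := Num.min d1 (Num.min d2 d3).
have t0 : 0 < t by rewrite !lt_min d10 d20.
have [t1 t2 t3] : [/\ t <= d1, t <= d2 & t <= d3] by rewrite /t !ge_min !lexx !orbT.
exists t; split => //; last by move=> v vH; case: (d3P t t0 t3 v vH).
split.
- by move=> e eH; have [] := d1P t t0 t1 e eH; rewrite mulrN -opprD oppr_le0.
- move=> S SH S0; rewrite inner_weight_lin.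
  by have [] // := d2P t t0 t2 S; rewrite mem_filter fpowersetE S0.
- by move=> v vH; rewrite degree_weight_lin; have [] := d3P t t0 t3 v vH.
Qed.

Definition tight_vertices (R : realType) (Delta : R) (H : graph)
    (y : {fset nat} -> R) : {fset nat} :=
  [fset v in vertices H | degree_weight H y v == Delta]%fset.

Definition maximum_forest (R : realType) (Delta : R) (H : graph)
    (y : {fset nat} -> R) : Prop :=
  fractional_forest Delta H y /\
  forall z, fractional_forest Delta H z ->
    \sum_(e <- edges H) z e <= \sum_(e <- edges H) y e.

(** Otherwise removing [w] from [S] would lose no weight, and [|S| - 1] vertices would carry weight
    [|S| - 1]. *)
Lemma tight_positive_edge (R : realType) (Delta : R) (H : graph) y S w :
  fractional_forest Delta H y -> tight H y S -> w \in S -> (S `\ w)%fset != fset0 ->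
  exists f, [/\ f \in edges H, (f `<=` S)%fset, w \in f & 0 < y f].
Proof.
move=> [y0 yS _] [SH S0 yeq] wS Sw0; apply: contrapT => nf.
have SwH : (S `\ w `<=` vertices H)%fset := fsubset_trans (fsubD1set _ _) SH.
have := yS _ SwH Sw0.
suff -> : inner_weight H y (S `\ w)%fset = inner_weight H y S.
  by rewrite yeq (cardfsD1 w S) wS add1n -natr1; lra.
rewrite /inner_weight [LHS]big_mkcond [RHS]big_mkcond /= big_seq [RHS]big_seq.
apply: eq_bigr => e eH; rewrite fsubsetD1.
have [eS|//] /= := boolP (e `<=` S)%fset; have [we|//] /= := boolP (w \in e).
apply/eqP; rewrite eq_le y0 // leNgt; apply/negP => ye.
by apply: nf; exists e.
Qed.

(* If the smallest tight set containing [e] met a tight vertex [w], weight could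
   be moved from an edge at [w] to [e], making [w] slack. *)
Lemma edge_tight_set (R : realType) (Delta : R) (H : graph) y e :
  maximum_forest Delta H y ->
  (forall z, maximum_forest Delta H z ->
    (#|` tight_vertices Delta H y| <= #|` tight_vertices Delta H z|)%N) ->
  e \in edges H -> (e `<=` vertices H `\` tight_vertices Delta H y)%fset ->
  exists S, [/\ tight H y S, (e `<=` S)%fset &
    (S `<=` vertices H `\` tight_vertices Delta H y)%fset].
Proof.
set T := tight_vertices Delta H y => -[fy ymax] minT eH eU.
have [y0 yS yD] := fy.
have eT v : v \in e -> v \notin T.
  by move=> /(fsubsetP eU); rewrite inE => /andP[].
have [u [v [uv eE uH vH]]] := edge_pair eH.
have TP w : w \in vertices H -> degree_weight H y w = Delta -> w \in T.
  by move=> wH dw; rewrite !inE /= wH dw eqxx.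
have exS : exists n, `[< exists S, [/\ tight H y S, (e `<=` S)%fset & #|` S| = n] >].
  (* If no tight set contained [e], raising [y e] alone would be feasible, since [e] misses [T], and
     would increase the maximal total. *)
  apply: contrapT => nS.
  have nS' S : tight H y S -> (e `<=` S)%fset -> False.
    by move=> tS eS; apply: nS; exists #|` S|; apply/asboolP; exists S.
  have [||||t [t0 ft _]] := @fractional_forest_perturb R Delta H y (fun g => (g == e)%:R).
  - exact: fy.
  - by move=> g _ _; rewrite ler0n.
  - move=> S tS; rewrite /inner_weight sum_indicator eH /=.
    by have /negP/negPf-> := nS' S tS.
  - move=> w wH dw; rewrite /degree_weight sum_indicator eH /=.
    by have := contraL (@eT w) (TP w wH dw) => /negPf->.
  have := ymax _ ft; rewrite big_split /= -mulr_sumr sum_indicator eH mulr1.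
  by rewrite gerDl leNgt t0.
case: (ex_minnP exS) => n /asboolP[S [tS eS Sn]] minS.
have [SH S0 yeq] := tS.
(* The intersection of two tight sets around [e] is tight, so the smallest one lies in all
   others. *)
have Smin S' : tight H y S' -> (e `<=` S')%fset -> (S `<=` S')%fset.
  move=> tS' eS'; have eI : (e `<=` S `&` S')%fset by rewrite fsubsetI eS.
  have [|_ tI] := tight_meet fy tS tS'.
    by apply/fset0Pn; exists u; apply: (fsubsetP eI); rewrite eE fset21.
  have /minS : `[< exists S1, [/\ tight H y S1, (e `<=` S1)%fset &
      #|` S1| = #|` (S `&` S')%fset|] >] by apply/asboolP; exists (S `&` S')%fset.
  rewrite -Sn => le; have /fsubset_cardP : #|` (S `&` S')%fset| = #|` S|.
    by apply/eqP; rewrite eqn_leq le fsubset_leq_card // fsubsetIl.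
  by move=> /(_ (fsubsetIl _ _))/fsetP <-; exact: fsubsetIr.
exists S; split => //; apply/fsubsetP => w wS; rewrite inE (fsubsetP SH) // andbT.
apply/negP => wT.
have we : w \notin e by apply: contraL wT; exact: eT.
have [|f [fH fS wf yf]] := tight_positive_edge fy tS wS.
  apply/fset0Pn; exists u; rewrite !inE (fsubsetP eS) ?eE ?fset21 // andbT.
  by apply: contraNneq we => <-; rewrite eE fset21.
(* The exchange direction moves weight from [f], an edge of positive weight at [w], to [e]. *)
pose p g : R := (g == e)%:R - (g == f)%:R.
have pI S' : inner_weight H p S' = (e `<=` S')%fset%:R - (f `<=` S')%fset%:R.
  by rewrite /inner_weight sumrB !sum_indicator eH fH.
have pV x : degree_weight H p x = (x \in e)%:R - (x \in f)%:R.
  by rewrite /degree_weight sumrB !sum_indicator eH fH.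
have [||||t [t0 ft tD]] := @fractional_forest_perturb R Delta H y p.
- exact: fy.
- move=> g _ yg; rewrite /p; have [gf|_] := eqVneq g f; last by rewrite subr0 ler0n.
  by rewrite -gf yg ltxx in yf.
(* A tight set containing [e] contains [S] and hence [f]: gain and loss cancel. *)
- move=> S' tS'; rewrite pI; have [eS'|_] := boolP (e `<=` S')%fset.
    by rewrite (fsubset_trans fS (Smin _ tS' eS')) subrr.
  by rewrite sub0r oppr_le0 ler0n.
- move=> x xH dx; rewrite pV (negPf (contraL (@eT x) (TP x xH dx))).
  by rewrite sub0r oppr_le0 ler0n.
set z := (fun g => y g + t * p g) in ft.
(* The total weight is unchanged, so [z] competes with [y] in the minimality of [T]. *)
have zmax : maximum_forest Delta H z.
  have zE : \sum_(g <- edges H) z g = \sum_(g <- edges H) y g.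
    by rewrite big_split /= -mulr_sumr sumrB !sum_indicator eH fH subrr mulr0 addr0.
  by split=> // z' /ymax; rewrite zE.
have := minT z zmax; rewrite leqNgt => /negP; apply.
(* The tight vertices of [z] form a proper subset of [T]: [w] has become slack and no slack vertex
   has become tight. *)
apply: fproper_ltn_card; rewrite fproperE; apply/andP; split; last first.
  apply/negP => /fsubsetP/(_ w wT); rewrite !inE /= => /andP[_].
  rewrite degree_weight_lin pV (negPf we) wf sub0r mulrN1.
  move: wT; rewrite !inE /= => /andP[_ /eqP->].
  by rewrite -subr_eq0 addrC addKr oppr_eq0 gt_eqF.
apply/fsubsetP => x; rewrite !inE /= degree_weight_lin => /andP[xH /eqP dx]; rewrite xH /=.
rewrite eq_le yD // leNgt; apply/negP => /(tD x xH).
by rewrite dx ltxx.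
Qed.

(** * Removing the tight vertices *)

Lemma induced_vertices (H : graph) : induced H (vertices H) = H.
Proof.
apply: graph_eq; first by rewrite /= fsetIid.
apply/fsetP => e; rewrite !inE /= andb_idr //; exact: edge_sub.
Qed.

(** Compare the coefficients of each edge according to whether it has 0, 1 or 2 ends in [T]; the
    degree sum counts the last kind twice. *)
Lemma sum_split_vertices (R : realType) (H : graph) (y : {fset nat} -> R) T :
  (T `<=` vertices H)%fset ->
  \sum_(e <- edges H) y e + inner_weight H y T =
  inner_weight H y (vertices H `\` T)%fset + \sum_(v <- T) degree_weight H y v.
Proof.
move=> TH; rewrite /inner_weight /degree_weight.
under [X in _ = _ + X]eq_bigr do rewrite big_mkcond.
rewrite exchange_big /= [X in _ + X = _]big_mkcond [X in _ = X + _]big_mkcond.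
rewrite -!big_split /= big_seq [RHS]big_seq; apply: eq_bigr => e eH.
have [u [v [uv -> uH vH]]] := edge_pair eH.
have -> : \sum_(w <- T) (if w \in [fset u; v]%fset then y [fset u; v]%fset else 0) =
    y [fset u; v]%fset * ((u \in T)%:R + (v \in T)%:R).
  transitivity (\sum_(w <- T) y [fset u; v]%fset * ((w == u)%:R + (w == v)%:R)).
    apply: eq_bigr => w _; rewrite !inE.
    have [->|_] := eqVneq w u; first by rewrite (negPf uv) /= addr0 mulr1.
    by rewrite /= add0r; case: eqP; rewrite ?mulr1 ?mulr0.
  by rewrite -mulr_sumr big_split /= !sum_indicator !andbT.
rewrite !fsubUset !fsub1set !in_fsetD uH vH !andbT.
by case: (u \in T); case: (v \in T) => /=; lra.
Qed.

Lemma f_sf_removal (R : realType) (Delta : R) (H : graph) : 0 <= Delta ->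
  f_bounded Delta H < f_sf R H ->
  exists2 X, (X `<=` vertices H)%fset &
    f_sf R (induced H (vertices H `\` X)%fset) + (Delta - 1) * #|` X|%:R + 1
      <= f_bounded Delta H.
Proof.
move=> D0 lt; have [y1 fy1 [bE y1max]] := f_bounded_attained H D0.
have exy : exists n, `[< exists2 y, maximum_forest Delta H y &
    #|` tight_vertices Delta H y| = n >].
  by exists #|` tight_vertices Delta H y1|; apply/asboolP; exists y1.
case: (ex_minnP exy) => n /asboolP[y mfy Tn] minn_.
have [fy ymax] := mfy; have [y0 yS yD] := fy.
set T := tight_vertices Delta H y in Tn.
have TH : (T `<=` vertices H)%fset by apply/fsubsetP => v; rewrite !inE /= => /andP[].
have minT z : maximum_forest Delta H z -> (#|` T| <= #|` tight_vertices Delta H z|)%N.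
  by move=> mz; rewrite Tn; apply: minn_; apply/asboolP; exists z.
have sE : f_bounded Delta H = \sum_(e <- edges H) y e.
  by rewrite bE; apply/eqP; rewrite eq_le ymax // y1max.
have UH : (vertices H `\` T `<=` vertices H)%fset := fsubsetDl _ _.
have le := tight_cover_le fy UH (fun e => @edge_tight_set R Delta H y e mfy minT).
have split_ := sum_split_vertices y TH.
have degT : \sum_(v <- T) degree_weight H y v = Delta * #|` T|%:R.
  rewrite card_fset_sum1 natr_sum mulr_sumr big_seq [RHS]big_seq.
  by apply: eq_bigr => v; rewrite !inE /= => /andP[_ /eqP->]; rewrite mulr1.
(* With [T] empty, the cover bound would give [f_sf R H <= f_bounded Delta H], against [lt]. *)
have [T0|T0] := eqVneq T fset0.
  move: le lt split_; rewrite sE degT T0 fsetD0 induced_vertices cardfs0 mulr0 addr0.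
  have -> : inner_weight H y fset0 = 0.
    rewrite /inner_weight big_seq_cond big1 // => e /andP[/edge_card e2].
    by rewrite fsubset0 => /eqP e0; rewrite e0 cardfs0 in e2.
  by lra.
(* The subset constraint for the nonempty [T] bounds its inner weight by [|T| - 1]; this [- 1]
   yields the [+ 1] of the conclusion. *)
exists T => //; rewrite sE; have := yS T TH T0.
by move: le split_; rewrite degT mulrBl mul1r; lra.
Qed.

(** * Node distance and Lipschitz approximation *)

Lemma node_dist_le n G G' : node_walk n G G' -> (node_dist G G' <= n)%N.
Proof.
by rewrite /node_dist; case: ex_minnP => m _ minm w; apply: minm; apply/asboolP.
Qed.

Lemma node_distP G G' : node_walk (node_dist G G') G G'.
Proof. by rewrite /node_dist; case: ex_minnP => m /asboolP. Qed.

Lemma node_dist_refl G : node_dist G G = 0%N.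
Proof. by apply/eqP; rewrite -leqn0; exact: (@node_dist_le 0). Qed.

Lemma node_dist_sym G G' : node_dist G G' = node_dist G' G.
Proof.
by apply/eqP; rewrite eqn_leq; apply/andP; split; apply: node_dist_le;
  apply: node_walk_sym; exact: node_distP.
Qed.

Lemma node_dist_triangle G2 G1 G3 :
  (node_dist G1 G3 <= node_dist G1 G2 + node_dist G2 G3)%N.
Proof. by apply: node_dist_le; apply: node_walk_cat (node_distP _ _) (node_distP _ _). Qed.

Lemma induced_induced (G : graph) S S' : (S' `<=` S)%fset ->
  induced (induced G S) S' = induced G S'.
Proof.
move=> S'S; apply: graph_eq => /=; first by rewrite -fsetIA (fsetIidPr S'S).
apply/fsetP => e; rewrite !inE /= -andbA; congr (_ && _).
by rewrite andb_idl // => /fsubset_trans; apply.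
Qed.

(** Delete the vertices of [X] one at a time. *)
Lemma node_dist_removal (H : graph) X : (X `<=` vertices H)%fset ->
  (node_dist H (induced H (vertices H `\` X)%fset) <= #|` X|)%N.
Proof.
have [n] := ubnP #|` X|; elim: n X => // n IHn X Xn XH.
have [->|[x xX]] := fset_0Vmem X.
  by rewrite fsetD0 induced_vertices node_dist_refl.
have XE := cardfsD1 x X; rewrite xX add1n in XE.
have X'H : (X `\ x `<=` vertices H)%fset := fsubset_trans (fsubD1set _ _) XH.
apply: leq_trans (node_dist_triangle (induced H (vertices H `\` (X `\ x))%fset) _ _) _.
rewrite XE -addn1; apply: leq_add; first by apply: IHn => //; rewrite XE ltnS in Xn.
have xH := fsubsetP XH _ xX.
apply: (@node_dist_le 1); eexists; last reflexivity.
left; exists x; first by rewrite /= !inE eqxx xH.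
rewrite /delete_vertex /= (fsetIidPr (fsubsetDl _ _)).
have -> : (vertices H `\` (X `\ x) `\ x)%fset = (vertices H `\` X)%fset.
  apply/fsetP => v; rewrite !inE; have [->|_] := eqVneq v x; last by [].
  by rewrite xX.
rewrite induced_induced //; apply/fsubsetP => v; rewrite !inE => /andP[vX ->].
by rewrite (negPf vX) andbF.
Qed.

(** * Error on induced subgraphs and its Lipschitz optimum *)

Lemma Err_ge (R : realType) (G : graph) (g f : graph -> R) S :
  (S `<=` vertices G)%fset -> `|g (induced G S) - f (induced G S)| <= Err G g f.
Proof.
move=> SV; apply: (le_bigmax_seq _ _ predT (fun S => `|g (induced G S) - f (induced G S)|)) => //.
by rewrite fpowersetE.
Qed.

Lemma Err_le (R : realType) (G : graph) (g f : graph -> R) b : 0 <= b ->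
  (forall S, (S `<=` vertices G)%fset ->
    `|g (induced G S) - f (induced G S)| <= b) -> Err G g f <= b.
Proof.
move=> b0 gfb; rewrite /Err big_seq; apply: bigmax_le => // S.
by rewrite fpowersetE; exact: gfb.
Qed.

(* The optimal error is half the largest violation of the Lipschitz condition;
   the McShane extension of [f - m] attains it. *)
Lemma Lipschitz_Err_minimum (R : realType) (c : R) (G : graph) (f : graph -> R) :
  0 <= c ->
  exists2 m, is_minimum [set Err G h f | h in Lipschitz c] m &
    forall S S', (S `<=` vertices G)%fset -> (S' `<=` vertices G)%fset ->
      f (induced G S) - f (induced G S') -
        c * (node_dist (induced G S) (induced G S'))%:R <= 2 * m.
Proof.
move=> c0; pose P := fpowerset (vertices G); pose g S := f (induced G S).
pose L S S' := g S - g S' - c * (node_dist (induced G S) (induced G S'))%:R.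
pose b := \big[Num.max/0]_(S <- P) \big[Num.max/0]_(S' <- P) L S S'.
have b0 : 0 <= b by rewrite /b; exact: bigmax_ge_id.
have bP S S' : (S `<=` vertices G)%fset -> (S' `<=` vertices G)%fset -> L S S' <= b.
  move=> SV S'V.
  apply: (@le_trans _ _ (\big[Num.max/0]_(S' <- P) L S S')).
    by apply: (le_bigmax_seq _ _ predT (fun S' => L S S')) => //; rewrite fpowersetE.
  apply: (le_bigmax_seq _ _ predT (fun S => \big[Num.max/0]_(S' <- P) L S S')) => //.
  by rewrite fpowersetE.
have bb : 2 * (b / 2) = b by rewrite mulrC divfK // pnatr_eq0.
exists (b / 2); last by move=> S S' SV S'V; rewrite bb; exact: bP.
(* Each violation [L S S'] is at most the sum of the errors of [h] at [S] and [S'], hence at most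
   twice [Err G h f]. *)
have lb h : Lipschitz c h -> b / 2 <= Err G h f.
  move=> hL; rewrite ler_pdivrMr //.
  have E0 : 0 <= Err G h f by rewrite /Err; exact: bigmax_ge_id.
  rewrite /b big_seq; apply: bigmax_le => [|S]; first by rewrite mulr_ge0.
  rewrite fpowersetE => SV; rewrite big_seq; apply: bigmax_le => [|S'].
    by rewrite mulr_ge0.
  rewrite fpowersetE => S'V; rewrite /L /g.
  have := hL (induced G S) (induced G S').
  have := Err_ge h f SV; have := Err_ge h f S'V.
  rewrite !ler_norml => /andP[h1 h2] /andP[h3 h4] /andP[h5 h6]; lra.
(* [h] is the upper envelope of cones of slope [c] with apex values [g S - b / 2]. The default
   [F K fset0] is itself one of the terms, so it does not alter the maximum. *)
pose F K S := g S - b / 2 - c * (node_dist K (induced G S))%:R.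
pose h K := \big[Num.max/F K fset0]_(S <- P) F K S.
have hge K S : (S `<=` vertices G)%fset -> F K S <= h K.
  by move=> SV; apply: (le_bigmax_seq _ _ predT (F K)) => //; rewrite fpowersetE.
have hle K r : (forall S, (S `<=` vertices G)%fset -> F K S <= r) -> h K <= r.
  move=> Fr; rewrite /h big_seq; apply: bigmax_le => [|S]; first exact/Fr/fsub0set.
  by rewrite fpowersetE; exact: Fr.
have hD K K' : h K <= h K' + c * (node_dist K K')%:R.
  apply: hle => S SV; rewrite -lerBlDr; apply: le_trans (hge K' S SV).
  have : c * (node_dist K' (induced G S))%:R <=
      c * ((node_dist K' K)%:R + (node_dist K (induced G S))%:R).
    by rewrite ler_wpM2l // -natrD ler_nat node_dist_triangle.
  by rewrite /F (node_dist_sym K K') mulrDr; lra.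
have hL : Lipschitz c h.
  move=> K K'; have := hD K K'; have := hD K' K.
  by rewrite (node_dist_sym K' K) ler_norml => h1 h2; apply/andP; split; lra.
split; last by move=> _ [k kL <-]; exact: lb.
exists h => //; apply/eqP; rewrite eq_le lb // andbT; apply: Err_le.
  by rewrite divr_ge0.
(* The cone at [S] itself gives the lower bound; the upper bound says that no violation exceeds
   [b]. *)
move=> S SV; rewrite ler_norml; apply/andP; split.
  by have := hge (induced G S) S SV; rewrite /F /g node_dist_refl mulr0; lra.
rewrite lerBlDr; apply: hle => S' S'V; have := bP S' S S'V SV.
by rewrite /L /F /g (node_dist_sym (induced G S')); lra.
Qed.

Theorem theorem1p11 (R : realType) (Delta : R) (G : graph) :
  1 <= Delta ->
  0 < Err G (f_bounded Delta) (@f_sf R) ->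
  exists2 m : R,
    is_minimum [set Err G f (@f_sf R) | f in Lipschitz (Delta - 1)] m &
    Err G (f_bounded Delta) (@f_sf R) <= 2 * m - 1.
Proof.
move=> D1 Err0; have D0 : 0 <= Delta := le_trans ler01 D1.
have c0 : 0 <= Delta - 1 by rewrite subr_ge0.
have [m mmin mP] := Lipschitz_Err_minimum G (@f_sf R) c0.
exists m => //.
pose err S := `|f_bounded Delta (induced G S) - f_sf R (induced G S)|.
have errP S : (S `<=` vertices G)%fset -> 0 < err S -> err S <= 2 * m - 1.
  move=> SV; rewrite /err; set H := induced G S.
  have le : f_bounded Delta H <= f_sf R H.
    by have [y fy [-> _]] := f_bounded_attained H D0; exact: fractional_forest_le fy.
  rewrite distrC normr_gt0 subr_eq0 eq_sym => ne.
  have lt : f_bounded Delta H < f_sf R H by rewrite lt_neqAle ne.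
  rewrite ger0_norm ?subr_ge0 //.
  have [X XH hX] := f_sf_removal D0 lt.
  have HE : vertices H = S by rewrite /= (fsetIidPr SV).
  (* Compare [H] with [H] minus [X]: the drop of [f_sf] beyond [(Delta - 1) * |X|] is at most
     [2 * m], and [hX] turns it into the error at [H] plus 1. *)
  have := mP S (S `\` X)%fset SV (fsubset_trans (fsubsetDl _ _) SV).
  have := node_dist_removal XH; rewrite -(ler_nat R).
  move: hX; rewrite HE /H induced_induced ?fsubsetDl // => hX hd.
  have := ler_wpM2l c0 hd; lra.
(* One subgraph of positive error forces [0 < 2 * m - 1], which settles the subgraphs of zero error
   and the base value 0 of [Err]. *)
have [S SV eS] : exists2 S, (S `<=` vertices G)%fset & 0 < err S.
  apply: contrapT => nS; move: Err0; rewrite ltNge => /negP; apply.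
  apply: Err_le => // S SV; rewrite leNgt; apply/negP => eS.
  by apply: nS; exists S.
apply: Err_le => [|S' S'V]; first exact: le_trans (ltW eS) (errP S SV eS).
have [/(errP S' S'V)//|] := ltP 0 (err S').
by move/le_trans; apply; exact: le_trans (ltW eS) (errP S SV eS).
Qed.
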